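(* Let $K$ be a field of characteristic different from $2$ and let $A$ be a finite-dimensional Malcev algebra over $K$. Then the following conditions are equivalent: (i) $A$ is right nilpotent; (ii) $A$ is nilpotent; (iii) $A$ is strongly nilpotent.
   Context: For a (not necessarily associative) $K$-algebra $A$, the Jacobian is $J(x,y,z)=(xy)z+(yz)x+(zx)y$. $A$ is a Malcev algebra if $x^2=0$ for all $x\in A$ and $J(x,y,xz)=J(x,y,z)x$ for all $x,y,z\in A$. A right product of length $m$ is $s_ms_{m-1}\cdots s_1:=((\cdots((s_ms_{m-1})s_{m-2})\cdots)s_2)s_1$. For an ideal $B$ of $A$ and an integer $n\ge1$: $B^n$ is the subspace spanned by all right products of length $n$ all of whose factors lie in $B$; $B^{\{n\}}$ is the subspace spanned by all products, bracketed in any way, of $n$ elements of $B$; $B^{\langle n\rangle}$ is the set of sums of products (bracketed in any way) of elements of $A$ with at least $n$ factors in $B$. The ideal $B$ is right nilpotent (respectively nilpotent, strongly nilpotent) if there is an integer $n\ge1$ with $B^n=\{0\}$ (respectively $B^{\{n\}}=\{0\}$, $B^{\langle n\rangle}=\{0\}$). These notions are applied to $A$ itself by taking $B=A$. *)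

(* Defs.v *)
From mathcomp Require Import all_boot all_algebra.

Set Implicit Arguments.
Unset Strict Implicit.
Unset Printing Implicit Defensive.

Import GRing.Theory.
Local Open Scope ring_scope.

(* A (not necessarily associative) K-algebra is an lmodType over K together
   with a bilinear map mul; the definitions below only use the underlying
   function of mul. *)

Definition jacobian (K : fieldType) (A : lmodType K) (mul : A -> A -> A)
    (x y z : A) : A :=
  mul (mul x y) z + mul (mul y z) x + mul (mul z x) y.

Definition malcev (K : fieldType) (A : lmodType K) (mul : A -> A -> A) : Prop :=
  (forall x : A, mul x x = 0) /\
  (forall x y z : A,
     jacobian mul x y (mul x z) = mul (jacobian mul x y z) x).

(* Bracketed words: w presents the product (eval mul w), whose factors, listed
   from left to right with multiplicity, are (factors w). *)
Inductive word (T : Type) : Type :=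
| Leaf of T
| Node of word T & word T.

Fixpoint eval (T : Type) (mul : T -> T -> T) (w : word T) : T :=
  match w with
  | Leaf x => x
  | Node u v => mul (eval mul u) (eval mul v)
  end.

Fixpoint factors (T : Type) (w : word T) : seq T :=
  match w with
  | Leaf x => [:: x]
  | Node u v => factors u ++ factors v
  end.

Section Nilpotency.

Variables (K : fieldType) (A : vectType K) (mul : A -> A -> A).

(* The subspaces B below are meant to be ideals, but the definitions make
   sense for any subspace. *)
Implicit Types (B : {vspace A}) (P : A -> Prop) (n : nat) (x : A).

(* P may be infinite, so its linear span is given as a predicate: the union of
   the spans of the finite sequences of elements of P. *)
Definition linear_span P x : Prop :=
  exists2 s : seq A, (forall y, y \in s -> P y) & x \in <<s>>%VS.

Definition finite_sums P x : Prop :=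
  exists2 s : seq A, (forall y, y \in s -> P y) & x = \sum_(y <- s) y.

(* x = ((a s_1) s_2) ... s_k with n = k + 1 factors, all in B. *)
Definition right_product B n x : Prop :=
  exists (a : A) (s : seq A),
    [/\ size (a :: s) = n, {subset a :: s <= B} & x = foldl mul a s].

Definition bracketed_product B n x : Prop :=
  exists w : word A,
    [/\ size (factors w) = n, {subset factors w <= B} & x = eval mul w].

Definition mixed_product B n x : Prop :=
  exists2 w : word A,
    (n <= count [in B] (factors w))%N & x = eval mul w.

(* B^n, B^{n} and B^<n>, respectively *)
Definition right_power B n : A -> Prop := linear_span (right_product B n).
Definition power B n : A -> Prop := linear_span (bracketed_product B n).
Definition strong_power B n : A -> Prop := finite_sums (mixed_product B n).

Definition right_nilpotent B : Prop :=
  exists2 n : nat, (0 < n)%N & forall x, right_power B n x <-> x = 0.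

Definition nilpotent B : Prop :=
  exists2 n : nat, (0 < n)%N & forall x, power B n x <-> x = 0.

Definition strongly_nilpotent B : Prop :=
  exists2 n : nat, (0 < n)%N & forall x, strong_power B n x <-> x = 0.

End Nilpotency.

(* Main.v *)
Require Import Defs.
From mathcomp Require Import all_boot all_algebra.

(* A bracketed product of 2 ^ n elements has a branch of length at least n in
   its bracketing tree.  In an anticommutative algebra each product along that
   branch can be turned so that the branch enters from the left; this makes the
   whole product, up to a sign, a right product of length n + 1.  Hence right
   nilpotency of the algebra itself implies nilpotency.  Conversely, a right
   product is a bracketed product, and a product with more than n factors
   becomes one with exactly n factors on reading some of its subproducts as
   single factors. *)

Local Open Scope ring_scope.

Import GRing.Theory.

Fixpoint height {T : Type} (w : word T) : nat :=
  match w with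
  | Leaf _ => 0
  | Node u v => (maxn (height u) (height v)).+1
  end.

Section Words.

Variables (T : Type) (mul : T -> T -> T).

Lemma size_factors_gt0 (w : word T) : (0 < size (factors w))%N.
Proof. by elim: w => //= u IHu v _; rewrite size_cat addn_gt0 IHu. Qed.

Lemma size_factors_le_exp_height (w : word T) :
  (size (factors w) <= 2 ^ height w)%N.
Proof.
elim: w => //= u IHu v IHv; rewrite size_cat expnS mul2n -addnn.
apply: leq_add; [apply: leq_trans IHu _ | apply: leq_trans IHv _];
  by rewrite leq_exp2l // ?leq_maxl ?leq_maxr.
Qed.

Lemma eval_with_size_factors {w : word T} {n : nat} :
  (0 < n)%N -> (n <= size (factors w))%N ->
  exists2 w' : word T, size (factors w') = n & eval mul w' = eval mul w.
Proof.
elim: w n => [x|u IHu v IHv] [//|[|n]] //= _; first by exists (Leaf x).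
  by move=> _; exists (Leaf (eval mul (Node u v))).
rewrite size_cat => le_n.
have u_gt0 := size_factors_gt0 u; have v_gt0 := size_factors_gt0 v.
(* The target length is now [n.+2]. If [u] leaves room for at least one more factor, it is kept
   whole and [v] is shortened; otherwise [v] collapses to one leaf and [u] is shortened to [n.+1]
   factors. *)
have [le_un | lt_nu] := leqP (size (factors u)) n.+1.
  have [||v' sz_v' ev_v'] := IHv (n.+2 - size (factors u))%N.
  - by rewrite subn_gt0.
  - by rewrite leq_subLR.
  exists (Node u v') => /=; last by rewrite ev_v'.
  by rewrite size_cat sz_v' subnKC // ltnW.
have [||u' sz_u' ev_u'] := IHu n.+1 => //; first exact: ltnW.
have [||v' sz_v' ev_v'] := IHv 1%N => //.
exists (Node u' v') => /=; last by rewrite ev_u' ev_v'.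
by rewrite size_cat sz_u' sz_v' addn1.
Qed.

Lemma foldl_is_eval (a : T) (s : seq T) :
  exists2 w : word T, factors w = a :: s & eval mul w = foldl mul a s.
Proof.
elim/last_ind: s => [|s x [w fac_w ev_w]]; first by exists (Leaf a).
exists (Node w (Leaf x)) => /=; first by rewrite fac_w cats1.
by rewrite ev_w foldl_rcons.
Qed.

End Words.

Section Nilpotency.

Variables (K : fieldType) (A : vectType K).

(** Reduces nilpotency to single products. The empty sequence puts 0 in the span even when [P] holds
    nowhere. *)
Lemma linear_span_eq0 (P : A -> Prop) :
  (forall x, linear_span P x <-> x = 0) <-> (forall x, P x -> x = 0).
Proof.
split=> [P0 x Px | P0 x]; last split=> [[s sP] | ->].
- apply/P0; exists [:: x]; last exact: memv_span1.
  by move=> y; rewrite inE => /eqP ->.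
- suff /span_subvP/subvP le_s0 : {subset s <= (0%VS : {vspace A})}.
    by move/le_s0; rewrite memv0 => /eqP.
  by move=> y /sP/P0 ->; rewrite mem0v.
- by exists [::]; rewrite ?mem0v.
Qed.

Lemma finite_sums_eq0 (P : A -> Prop) :
  (forall x, finite_sums P x <-> x = 0) <-> (forall x, P x -> x = 0).
Proof.
split=> [P0 x Px | P0 x]; last split=> [[s sP ->] | ->].
- apply/P0; exists [:: x]; last by rewrite big_seq1.
  by move=> y; rewrite inE => /eqP ->.
- by rewrite big_seq big1 // => y /sP/P0.
- by exists [::]; rewrite ?big_nil.
Qed.

Lemma nilpotent_right_nilpotent (mul : A -> A -> A) (B : {vspace A}) :
  nilpotent mul B -> right_nilpotent mul B.
Proof.
case=> n n_gt0 /linear_span_eq0 nilB; exists n => //.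
apply/linear_span_eq0 => _ [a [s [sz_as sB ->]]].
have [w fac_w ev_w] := foldl_is_eval _ mul a s.
by apply: nilB; exists w; rewrite fac_w ev_w.
Qed.

Lemma strongly_nilpotent_nilpotent (mul : A -> A -> A) (B : {vspace A}) :
  strongly_nilpotent mul B -> nilpotent mul B.
Proof.
case=> n n_gt0 /finite_sums_eq0 nilB; exists n => //.
apply/linear_span_eq0 => _ [w [sz_w wB ->]]; apply: nilB; exists w => //.
(* All factors lie in [B], so the count is the full length. *)
by rewrite -sz_w -size_filter (all_filterP _) //; apply/allP.
Qed.

Lemma nilpotent_strongly_nilpotent_fullv (mul : A -> A -> A) :
  nilpotent mul fullv -> strongly_nilpotent mul fullv.
Proof.
case=> n n_gt0 /linear_span_eq0 nilA; exists n => //.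
apply/finite_sums_eq0 => _ [w le_n ->].
have [w' sz_w' <-] :=
  eval_with_size_factors _ mul n_gt0 (leq_trans le_n (count_size _ _)).
(* The leaves of [w'] may be subproducts of [w]; in [fullv] they are still admissible factors. *)
by apply: nilA; exists w'; split=> // x _; apply: memvf.
Qed.

Section Anticommutative.

Variable mul : {bilinear A -> A -> A}.
Hypothesis mulxx : forall x, mul x x = 0.

Lemma alternating_anticommutative (x y : A) : mul x y = - mul y x.
Proof.
have := mulxx (x + y); rewrite linearDl !linearDr !mulxx add0r addr0 => /eqP.
by rewrite addr_eq0 => /eqP.
Qed.

Lemma foldl_bilinearN (a : A) (s : seq A) :
  foldl mul (- a) s = - foldl mul a s.
Proof. by elim: s a => //= x s IHs a; rewrite linearNl IHs. Qed.

(** Descending a longest branch, one may stop after [m] steps and take the value of the remaining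
    subtree, up to sign, as [a]. *)
Lemma eval_is_foldl {w : word A} {m : nat} : (m <= height w)%N ->
  exists a (s : seq A), size s = m /\ eval mul w = foldl mul a s.
Proof.
elim: w m => [x|u IHu v IHv] [|m] //=; first by exists x, [::].
  by exists (mul (eval mul u) (eval mul v)), [::].
rewrite ltnS leq_max => /orP[/IHu | /IHv] [a [s [<- ev_as]]].
  exists a, (rcons s (eval mul v)).
  by rewrite size_rcons foldl_rcons ev_as.
(* The branch enters from the right here: the sign from swapping the factors is moved into the
   initial element. *)
exists (- a), (rcons s (eval mul u)).
rewrite size_rcons foldl_rcons foldl_bilinearN linearNl -ev_as.
by rewrite -alternating_anticommutative.
Qed.

Lemma right_nilpotent_nilpotent_fullv :
  right_nilpotent mul fullv -> nilpotent mul fullv.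
Proof.
(* The right nilpotency exponent is [n.+1]: the initial element and [n] further factors, hence a
   branch of length [n]. *)
case=> [[//|n] _ /linear_span_eq0 nilA]; exists (2 ^ n)%N.
  by rewrite expn_gt0.
apply/linear_span_eq0 => _ [w [sz_w _ ->]].
have le_n : (n <= height w)%N.
  by rewrite -(@leq_exp2l 2) // -sz_w size_factors_le_exp_height.
have [a [s [sz_s ->]]] := eval_is_foldl le_n.
by apply: nilA; exists a, s; split=> [/=|x _|//]; rewrite ?sz_s ?memvf.
Qed.

End Anticommutative.

End Nilpotency.

Theorem mainTheorem3 (K : fieldType) (A : vectType K)
    (mul : {bilinear A -> A -> A})
    (char_neq2 : 2%N \notin [pchar K])
    (malcev_A : malcev mul) :
  (right_nilpotent mul (fullv : {vspace A}) <->
     nilpotent mul (fullv : {vspace A})) /\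
  (nilpotent mul (fullv : {vspace A}) <->
     strongly_nilpotent mul (fullv : {vspace A})).
Proof.
have [mulxx _] := malcev_A; split; split.
- exact: right_nilpotent_nilpotent_fullv.
- exact: nilpotent_right_nilpotent.
- exact: nilpotent_strongly_nilpotent_fullv.
- exact: strongly_nilpotent_nilpotent.
Qed.
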